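(* Let $k\in\mathbb N$ and let $\mathcal R:=(V,\leq,\rho_1,\dots,\rho_k)$ be an ordered binary structure (that is, $\leq$ is a linear order on $V$ and each $\rho_i$ is a binary relation on $V$). Then $\mathcal R$ has a finite monomorphic decomposition if and only if every structure $\mathcal R_i:=(V,\leq,\rho_i)$, $1\leq i\leq k$, has a finite monomorphic decomposition.
   Context: A monomorphic decomposition of a relational structure $\mathcal R$ with domain $V$ is a partition $(V_j)_{j\in J}$ of $V$ such that for all finite subsets $A,A'$ of $V$, the induced structures $\mathcal R_{\restriction A}$ and $\mathcal R_{\restriction A'}$ are isomorphic whenever $|A\cap V_j|=|A'\cap V_j|$ for every $j\in J$. It is finite if it has finitely many blocks. *)

(* Defs.v *)
From mathcomp Require Import all_boot all_order.
From mathcomp Require Import all_classical.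

Set Implicit Arguments.
Unset Strict Implicit.
Unset Printing Implicit Defensive.

Local Open Scope classical_set_scope.

Definition structure (S : Type) (ar : S -> nat) (V : Type) :=
  forall s : S, set ((ar s).-tuple V).

(* The domain of the induced structure is the subtype [set_type A]. *)
Definition induced (S : Type) (ar : S -> nat) (V : Type)
    (R : structure ar V) (A : set V) : structure ar (set_type A) :=
  fun s t => R s (map_tuple (@set_val V A) t).
Arguments induced {S ar V} R A s t.

Definition isomorphic (S : Type) (ar : S -> nat) (V W : Type)
    (R : structure ar V) (Q : structure ar W) : Prop :=
  exists2 f : V -> W, bijective f &
    forall (s : S) (t : (ar s).-tuple V), R s t <-> Q s (map_tuple f t).

(* [classical_sets.partition] requires nonempty, pairwise disjoint blocks
   covering the whole domain. *)
Definition monomorphic_decomposition (S : Type) (ar : S -> nat) (V : Type)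
    (R : structure ar V) (J : Type) (B : J -> set V) : Prop :=
  classical_sets.partition [set: J] B [set: V] /\
  forall A A' : set V, finite_set A -> finite_set A' ->
    (forall j, ((A `&` B j) #= (A' `&` B j))%card) ->
    isomorphic (induced R A) (induced R A').

Definition has_finite_monomorphic_decomposition (S : Type) (ar : S -> nat)
    (V : Type) (R : structure ar V) : Prop :=
  exists (J : finType) (B : J -> set V), monomorphic_decomposition R B.

(* [None] names the linear order and [Some i] names [rho i]. *)
Definition ordered_binary (d : Order.disp_t) (V : orderType d) (I : Type)
    (rho : I -> V -> V -> Prop) : structure (fun _ : option I => 2) V :=
  fun s t => let x := tnth t ord0 in let y := tnth t ord_max in
    if s is Some i then rho i x y else (x <= y)%O.
Arguments ordered_binary {d V I} rho s t.

(* Main.v *)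
Require Import Defs.
From mathcomp Require Import all_boot all_order finmap.
From mathcomp Require Import all_classical.

(** Any two isomorphisms between finite ordered structures preserve the order,
    and a finite chain has no nontrivial order automorphism; hence between two
    finite chains there is at most one order isomorphism
    ([order_isomorphism_unique]), and there is one when they have equal
    cardinality ([order_isomorphism_exists]).  So, for finite
    [A] and [A'] of equal cardinality, the restrictions of the full structure
    are isomorphic as soon as those of every single [(V, <=, rho i)] are: the
    separate isomorphisms are all the same map.

    It follows that the common refinement of monomorphic decompositions of the
    structures [(V, <=, rho i)] is a monomorphic decomposition of the full
    structure: two sets that meet every block of the refinement in equally many
    points also meet every block of each coarser partition in equally many
    points ([card_eq_fibers]).  Conversely, a decomposition of the full
    structure serves for its reducts.

    Finite partitions are handled as the fibres of maps into a finite type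
    ([finite_decompositionP]), so that the common refinement is given by the
    product of the maps. *)

Set Implicit Arguments.
Unset Strict Implicit.
Unset Printing Implicit Defensive.

Import Order.TTheory.

Local Open Scope classical_set_scope.
Local Open Scope card_scope.

(** Both cardinals are the sum over [j] of those of the fibres; this is how
    equality of block counts passes from a partition to a coarser one. *)
Lemma card_eq_fibers (T : choiceType) (J : finType) (c : T -> J)
    (A A' : set T) :
  finite_set A -> finite_set A' ->
  (forall j, A `&` c @^-1` [set j] #= A' `&` c @^-1` [set j]) -> A #= A'.
Proof.
have cardE (B : set T) : finite_set B ->
    #|` fset_set B| = \sum_(j : J) #|` fset_set (B `&` c @^-1` [set j])|.
  move=> finB; rewrite card_fset_sum1 (partition_big c xpredT)//=.
  apply: eq_bigr => j _; rewrite [RHS]card_fset_sum1 big_fset_condE.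
  congr (bigop.body _ _ _); congr (enum_fset _); apply/fsetP => x.
  rewrite !inE/= !in_fset_set//; last exact: finite_setIl.
  rewrite in_setI; congr (_ && _).
  by apply/eqP/idP; rewrite inE.
move=> finA finA' h; apply/fcard_eq => //.
rewrite !cardE//; apply: eq_bigr => j _.
by apply/fcard_eq; [exact: finite_setIl|exact: finite_setIl|exact: h].
Qed.

(** A colouring need not be surjective, whereas blocks must be nonempty: from
    right to left the index type is cut down to the colours that occur, and the
    condition at the others is trivial, both traces being empty. *)
Lemma finite_decompositionP (S : Type) (ar : S -> nat) (V : Type)
    (R : structure ar V) :
  has_finite_monomorphic_decomposition R <->
  exists (J : finType) (c : V -> J), forall A A' : set V,
    finite_set A -> finite_set A' ->
    (forall j, A `&` c @^-1` [set j] #= A' `&` c @^-1` [set j]) ->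
    isomorphic (induced R A) (induced R A').
Proof.
split=> [[J [B [[covB trivB neB] monoB]]]|[J [c monoc]]].
  have /boolp.choice[c cP] : forall x, exists j, B j x.
    move=> x; have [j _ Bjx] : cover [set: J] B x by rewrite covB.
    by exists j.
  exists J, c => A A' finA finA' h; apply: monoB => // j.
  suff -> : B j = c @^-1` [set j] by exact: h.
  apply/seteqP; split=> x /= => [Bjx|<-//].
  by apply: trivB => //; exists x; split=> //; exact: cP.
pose K := {j : J | `[< exists x, c x = j >]}.
exists K, (fun k => c @^-1` [set val k]); split; last first.
  move=> A A' finA finA' h; apply: monoc => // j.
  have [jP|njP] := pselect (exists x, c x = j).
    by have := h (exist _ j (asboolT jP)).
  suff -> : c @^-1` [set j] = set0 by rewrite !setI0.
  by apply/seteqP; split=> x //= cx; apply: njP; exists x.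
split.
- apply/seteqP; split=> // x _.
  have jP : `[< exists y, c y = c x >] by apply/asboolP; exists x.
  by exists (exist _ (c x) jP).
- move=> k l _ _ [x [/= kx lx]]; apply: val_inj.
  exact: etrans (esym kx) lx.
- by move=> [j jP] _; have [x] := asboolW jP; exists x.
Qed.

(** The order is compared in [V], through [set_val], because subsets of [V]
    carry no order structure of their own. *)
Definition order_isomorphism (d : Order.disp_t) (V : orderType d)
    (A A' : set V) (f : A -> A') : Prop :=
  bijective f /\
  forall x y, (set_val (f x) <= set_val (f y))%O = (set_val x <= set_val y)%O.

(** Separates the order from the relations [rho i], so that the isomorphism can
    be determined from the order alone. *)
Lemma isomorphic_orderedP (d : Order.disp_t) (V : orderType d) (I : Type)
    (rho : I -> V -> V -> Prop) (A A' : set V) :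
  isomorphic (induced (ordered_binary rho) A)
             (induced (ordered_binary rho) A') <->
  exists2 f : A -> A', order_isomorphism f &
    forall i x y, rho i (set_val x) (set_val y) <->
                  rho i (set_val (f x)) (set_val (f y)).
Proof.
split=> [[f bijf fP]|[f [bijf fle] fP]]; exists f => //.
- split=> // x y; have := fP None [tuple x; y].
  rewrite /induced /ordered_binary !(tnth_map, tnth0) !(tnth_nth x) /= => h.
  by apply/idP/idP => /h.
- move=> i x y; have := fP (Some i) [tuple x; y].
  by rewrite /induced /ordered_binary !tnth_map !(tnth_nth x).
move=> [i|] t; rewrite /induced /ordered_binary !tnth_map; first exact: fP.
by rewrite fle.
Qed.

(** Induction along the finite chain [A].  If [f] and [g] agree strictly below
    [x] but, say, [f x < g x], then [g] takes the value [f x] at some [y < x];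
    there [f y = g y = f x], although [f y < f x]. *)
Lemma order_isomorphism_unique (d : Order.disp_t) (V : orderType d)
    (A A' : set V) (f g : A -> A') :
  finite_set A -> order_isomorphism f -> order_isomorphism g -> f = g.
Proof.
move=> finA.
have lt_iso (h : A -> A') : order_isomorphism h ->
    forall x y, (set_val (h x) < set_val (h y))%O = (set_val x < set_val y)%O.
  by move=> [_ hle] x y; rewrite !ltNge hle.
suff agree_below_le (h k : A -> A') x : order_isomorphism h -> order_isomorphism k ->
    (forall y, (set_val y < set_val x)%O -> h y = k y) ->
    (set_val (k x) <= set_val (h x))%O.
  move=> isof isog; apply/funext => x.
  pose s := sort <=%O (fset_set A : seq V).
  have sA (y : A) : set_val y \in s.
    by rewrite mem_sort in_fset_set// inE; exact: set_valP.
  (* The induction is on the position of [x] in the increasing list of [A]. *)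
  have [n] := ubnP (index (set_val x) s).
  elim: n => // n IHn in x *; rewrite ltnS => xn.
  have IHx y : (set_val y < set_val x)%O -> f y = g y.
    move=> yx; apply: IHn; apply: leq_trans xn; rewrite ltnNge.
    apply: contraL yx => xy; rewrite -leNgt.
    by apply: (sorted_leq_index le_trans le_refl) xy => //; exact: sort_le_sorted.
  apply: val_inj; apply/eqP; rewrite eq_le !agree_below_le// => y /IHx//.
move=> isoh isok eq_hk; rewrite leNgt; apply/negP => hk.
have [[k' k'K kK'] _] := isok.
have yx : (set_val (k' (h x)) < set_val x)%O by rewrite -(lt_iso k)// kK'.
have := yx; rewrite -(lt_iso h)// (eq_hk _ yx) kK'.
by rewrite ltxx.
Qed.

(** Match the increasing enumerations of [A] and [A'] position by position. *)
Lemma order_isomorphism_exists (d : Order.disp_t) (V : orderType d)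
    (A A' : set V) :
  finite_set A -> finite_set A' -> A #= A' ->
  exists f : A -> A', order_isomorphism f.
Proof.
move=> finA finA' /(fcard_eq finA finA') eqAA'.
pose s (B : set V) := sort <=%O (fset_set B : seq V).
have ltsorted B : sorted <%O (s B) by rewrite sort_lt_sorted fset_uniq.
have mems B (x : V) : finite_set B -> x \in s B <-> B x.
  by move=> finB; rewrite mem_sort in_fset_set// inE.
have sizes : size (s A) = size (s A') by rewrite !size_sort.
(* The default [x] of [nth] is never reached on [B]; it only spares the choice
   of a point in a possibly empty [V]. *)
pose t (B C : set V) (x : V) := nth x (s C) (index x (s B)).
have tP B C x : finite_set B -> finite_set C -> size (s B) = size (s C) ->
    B x -> C (t B C x).
  move=> finB finC eqs /(mems _ _ finB) Bx.
  by apply/mems => //; rewrite mem_nth// -eqs index_mem.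
have tK B C x : finite_set B -> size (s B) = size (s C) -> B x ->
    t C B (t B C x) = x.
  move=> finB eqs /(mems _ _ finB) Bx.
  rewrite /t index_uniq ?sort_uniq ?fset_uniq// -?eqs ?index_mem//.
  by rewrite (set_nth_default x) ?index_mem// nth_index.
pose f B C finB finC eqs (x : set_type B) : set_type C :=
  exist _ (t B C (set_val x)) (mem_set (tP B C _ finB finC eqs (set_valP x))).
exists (f A A' finA finA' sizes); split.
  exists (f A' A finA' finA (esym sizes)) => x; apply: val_inj => /=;
  by apply: tK => //; exact: set_valP.
move=> x y.
have /(mems _ _ finA) sx := set_valP x; have /(mems _ _ finA) sy := set_valP y.
have -> : set_val (f _ _ finA finA' sizes y) =
    nth (set_val x) (s A') (index (set_val y) (s A)).
  by apply: set_nth_default; rewrite -sizes index_mem.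
have -> : set_val (f _ _ finA finA' sizes x) =
    nth (set_val x) (s A') (index (set_val x) (s A)) by [].
rewrite (lt_sorted_leq_nth _ (ltsorted A')) ?inE -?sizes ?index_mem//.
rewrite -(lt_sorted_leq_nth (set_val x) (ltsorted A)) ?inE ?index_mem//.
by rewrite !nth_index.
Qed.

Theorem proposition1p5 (k : nat) (d : Order.disp_t) (V : orderType d)
    (rho : 'I_k -> V -> V -> Prop) :
  has_finite_monomorphic_decomposition (ordered_binary rho) <->
  forall i : 'I_k,
    has_finite_monomorphic_decomposition
      (ordered_binary (fun _ : 'I_1 => rho i)).
Proof.
split=> [/finite_decompositionP[J [c cP]] i|rhoP].
  apply/finite_decompositionP; exists J, c => A A' finA finA' h.
  have /isomorphic_orderedP[f isof fP] := cP A A' finA finA' h.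
  by apply/isomorphic_orderedP; exists f => // _; exact: fP.
have {}rhoP i := (finite_decompositionP _).1 (rhoP i).
pose J i := projT1 (cid (rhoP i)).
pose c i : V -> J i := projT1 (cid (projT2 (cid (rhoP i)))).
have cP i := projT2 (cid (projT2 (cid (rhoP i)))).
apply/finite_decompositionP.
pose C (x : V) : {dffun forall i, J i} := [ffun i => c i x].
exists {dffun forall i, J i}, C => A A' finA finA' h.
(* When [k = 0] no single structure provides an isomorphism, so [f] is built
   from the order and afterwards identified with the isomorphism of each
   [(V, <=, rho i)]. *)
have [f isof] : exists f : A -> A', order_isomorphism f.
  by apply: order_isomorphism_exists => //; exact: card_eq_fibers h.
apply/isomorphic_orderedP; exists f => // i.
have {cP} : isomorphic (induced (ordered_binary (fun _ : 'I_1 => rho i)) A)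
                  (induced (ordered_binary (fun _ : 'I_1 => rho i)) A').
  apply: cP => // j; apply: (@card_eq_fibers _ _ C); [exact: finite_setIl..|].
  move=> g; rewrite -!setIA.
  (* The block of [C] at [g] lies in the block of [c i] at [g i]. *)
  have [<-|gij] := eqVneq (g i) j.
    suff -> : c i @^-1` [set g i] `&` C @^-1` [set g] = C @^-1` [set g].
      exact: h.
    by apply/setIidPr => x /= <-; rewrite ffunE.
  suff -> : c i @^-1` [set j] `&` C @^-1` [set g] = set0 by rewrite !setI0.
  apply/seteqP; split=> x //= [cx Cx].
  by move: gij; rewrite -Cx ffunE cx eqxx.
move=> /isomorphic_orderedP[f' isof' f'P].
by rewrite (order_isomorphism_unique finA isof isof'); exact: (f'P ord0).
Qed.
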